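(* As $n\to\infty$, $g(n,K_4|\langle P_3\rangle)=\Theta(n^{3/2})$, and also the smaller class $\langle\{K_3,P_4\}\rangle$ generates the same growth order: $g(n,K_4|\langle\{K_3,P_4\}\rangle)=\Theta(n^{3/2})$.
   Context: $P_k$ is the path on $k$ vertices. For a graph $F$, $\langle F\rangle$ is the family of all graphs containing $F$ as a subgraph (not necessarily induced); for a collection of graphs, $\langle\{F_1,\dots,F_k\}\rangle$ is the family of all graphs containing at least one $F_i$ as a subgraph. In an edge coloring of $K_n$ (not necessarily proper), for a copy $G'\subseteq K_n$ of a graph $G$, a color class of $G'$ is the graph formed by all edges of $G'$ having a given color that occurs in $G'$. For a family $\mathcal{F}$ of graphs with $K_2\notin\mathcal{F}$ and $n\ge|G|$, $g(n,G|\mathcal{F})$ is the largest integer $m$ for which there exists an edge coloring of $K_n$ using exactly $m$ colors such that every copy of $G$ contains a color class which is a member of $\mathcal{F}$; if no such coloring exists, then $g(n,G|\mathcal{F}):=0$. *)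

(* Defs.v *)
From Stdlib Require List.
From mathcomp Require Import all_boot all_order all_algebra.
From mathcomp Require Import all_classical all_reals all_analysis.
Import numFieldNormedType.Exports.

Set Implicit Arguments.
Unset Strict Implicit.
Unset Printing Implicit Defensive.

Record sgraph := SGraph {
  vertex :> finType;
  edge : rel vertex;
  edge_sym : symmetric edge;
  edge_irr : irreflexive edge }.

Definition complete_rel n : rel 'I_n := fun i j => i != j.

Lemma complete_sym n : symmetric (@complete_rel n).
Proof. by move=> i j; rewrite /complete_rel eq_sym. Qed.

Lemma complete_irr n : irreflexive (@complete_rel n).
Proof. by move=> i; rewrite /complete_rel eqxx. Qed.

Definition complete_graph n : sgraph :=
  SGraph (@complete_sym n) (@complete_irr n).

Definition path_rel n : rel 'I_n := fun i j => (i.+1 == j) || (j.+1 == i).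

Lemma path_sym n : symmetric (@path_rel n).
Proof. by move=> i j; rewrite /path_rel orbC. Qed.

Lemma path_irr n : irreflexive (@path_rel n).
Proof. by move=> i; rewrite /path_rel orbb eqn_leq ltnn. Qed.

Definition path_graph n : sgraph := SGraph (@path_sym n) (@path_irr n).

Definition contains (H F : sgraph) : Prop :=
  exists2 f : F -> H, injective f & forall x y, edge x y -> edge (f x) (f y).

(* A family of graphs, meant to be closed under isomorphism. *)
Definition family := sgraph -> Prop.

Definition generated (Fs : seq sgraph) : family :=
  fun H => List.Exists (contains H) Fs.

Definition edges_K n : {set {set 'I_n}} := [set e : {set 'I_n} | #|e| == 2]%SET.

Section Coloring.

(* Only the values of [c] on [edges_K n] are meaningful. *)
Variables (n : nat) (c : {set 'I_n} -> nat).

Definition num_colors : nat := size (undup [seq c e | e in edges_K n]).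

(* For injective [h], the copy of [G] in [K_n] is the image of [G] under [h].
   Its color classes are pulled back to [G] along [h], which does not change
   their isomorphism type. *)
Variables (G : sgraph) (h : G -> 'I_n) (k : nat).

Definition color_rel : rel G :=
  fun x y => edge x y && (c [set h x; h y]%SET == k).

(* A color class has no isolated vertices. *)
Definition class_vertex : finType := {x : G | [exists y, color_rel x y]}.

Definition class_rel : rel class_vertex := fun u v => color_rel (val u) (val v).

Lemma class_sym : symmetric class_rel.
Proof. by move=> u v; rewrite /class_rel /color_rel edge_sym finset.setUC. Qed.

Lemma class_irr : irreflexive class_rel.
Proof. by move=> u; rewrite /class_rel /color_rel edge_irr. Qed.

Definition color_class : sgraph := SGraph class_sym class_irr.

Definition color_occurs : Prop := exists x y, color_rel x y.

End Coloring.

Definition good_coloring n (G : sgraph) (F : family) (c : {set 'I_n} -> nat) :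
    Prop :=
  forall h : G -> 'I_n, injective h ->
  exists2 k, color_occurs c h k & F (color_class c h k).

Definition attainable n (G : sgraph) (F : family) (m : nat) : Prop :=
  exists2 c : {set 'I_n} -> nat, num_colors c = m & good_coloring G F c.

(* [g n G F] is g(n, G | F).  The range of the maximum is justified by
   [attainable_bound]; the maximum over the empty set is 0.  The intended use
   is [#|G| <= n] and [~ F (complete_graph 2)]. *)
Definition g n (G : sgraph) (F : family) : nat :=
  \max_(m < 'C(n, 2).+1 | `[< attainable n G F m >]) m.

Lemma attainable_bound n G F m : attainable n G F m -> m <= 'C(n, 2).
Proof.
case=> c <- _; rewrite /num_colors (leq_trans (size_undup _)) //.
by rewrite size_map -cardE card_draws card_ord.
Qed.

Lemma leq_g n G F m : attainable n G F m -> m <= g n G F.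
Proof.
move=> am; have lm : m < 'C(n, 2).+1 by rewrite ltnS (attainable_bound am).
by rewrite (bigmax_sup (Ordinal lm))//; apply/asboolP.
Qed.

Lemma g_attained n G F m : attainable n G F m -> attainable n G F (g n G F).
Proof.
move=> am; have lm : m < 'C(n, 2).+1 by rewrite ltnS (attainable_bound am).
rewrite /g (bigmax_eq_arg (Ordinal lm)); last exact/asboolP.
by case: arg_maxnP => [|i /asboolP//]; apply/asboolP.
Qed.

(* Main.v *)
Require Import Defs.
From mathcomp Require Import all_boot all_order all_algebra.
From mathcomp Require Import all_classical all_reals all_analysis.
From mathcomp Require Import finfield zify ring.
Import Order.TTheory Num.Theory GRing.Theory numFieldNormedType.Exports.

(** The two families satisfy <{K_3, P_4}> <= <P_3>, so it is enough to bound
    g(n, K_4 | <P_3>) from above and g(n, K_4 | <{K_3, P_4}>) from below.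

    Upper bound.  A coloring is good for <P_3> exactly when no K_4 is properly
    colored, that is, each K_4 has two adjacent edges of the same color.
    Delete the vertices one at a time.  Deleting v from a vertex set S loses
    only the private colors of v, those which appear within S at v alone.
    Choosing one edge per private color gives a star at v.  If two such stars
    had four common leaves, their centers together with two of these leaves
    would span a properly colored K_4 ([private_stars_K4]): privacy separates
    the colors at the two centers from each other and from the edge between
    the leaves.  So the leaf sets meet pairwise in at most three vertices, and
    k of them, each of size at least 4k, would cover at least k^2 vertices,
    which is impossible once k^2 > n.  Hence some vertex can always be deleted
    at the cost of at most 4k colors, for a total of at most 4kn
    ([card_palette_bound]), where k is of order n^(1/2).

    Lower bound.  Take a bipartite graph without C_4, give its edges distinct
    colors, and give one further color to all other pairs.  On any four
    vertices the further color contains a triangle, if three of them lie on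
    the same side, and otherwise a P_4, since one of the four crossing pairs
    is not an edge ([rainbow_on_good]).  The points and the non-vertical lines
    of the affine plane over a field with q elements form such a graph, with
    2q^2 vertices and q^3 edges ([leq_incidence_g]).  Powers q = 2^r suffice:
    every n >= 8 has one with 2q^2 <= n < 8q^2, and then q^3 and qn both have
    order n^(3/2). *)

Set Implicit Arguments.
Unset Strict Implicit.
Unset Printing Implicit Defensive.

(** * Sets with small pairwise intersections *)

Lemma card_setI_bigcup (I T : finType) (A : I -> {set T}) (B : {set T}) t
    (s : seq I) :
  (forall u, u \in s -> #|B :&: A u| <= t) ->
  #|B :&: \bigcup_(u <- s) A u| <= t * size s.
Proof.
elim: s => [|u s IH] Hs; first by rewrite big_nil finset.setI0 cards0.
rewrite big_cons finset.setIUr mulnS.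
apply: leq_trans (leq_card_setU _ _) _; apply: leq_add.
  by apply: Hs; rewrite mem_head.
by apply: IH => w ws; apply: Hs; rewrite inE ws orbT.
Qed.

(** Among the first k sets, each new one meets the union of its predecessors
    in at most t * k elements, so that at least k of its elements are new. *)
Lemma leq_card_bigcup_almost_disjoint (I T : finType) (A : I -> {set T}) t k
    (s : seq I) :
  uniq s -> size s <= k ->
  (forall u, u \in s -> t.+1 * k <= #|A u|) ->
  {in s &, forall u v, u != v -> #|A u :&: A v| <= t} ->
  size s * k <= #|\bigcup_(u <- s) A u|.
Proof.
elim: s => [|u s IH] //= /andP[us suniq] sk large meet.
rewrite big_cons.
have tail : size s * k <= #|\bigcup_(w <- s) A w|.
  apply: IH => //; first exact: ltnW.
    by move=> w ws; apply: large; rewrite inE ws orbT.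
  by move=> w w' ws ws'; apply: meet; rewrite inE ?ws ?ws' orbT.
have overlap : #|A u :&: \bigcup_(w <- s) A w| <= t * size s.
  apply: card_setI_bigcup => w ws; apply: meet; rewrite ?inE ?eqxx ?ws ?orbT //.
  by apply: contraNneq us => ->.
have ls : t * size s <= t * k by rewrite leq_mul2l (ltnW sk) orbT.
have := cardsUI (A u) (\bigcup_(w <- s) A w).
have := large u (mem_head _ _).
rewrite !mulSn; lia.
Qed.

(** * Colorings without a properly colored K4 *)

Section ProperK4.

Variables (T K : finType) (c : T -> T -> K).
Hypothesis c_sym : forall x y, c x y = c y x.

Definition properly_colored_K4 :=
  exists2 h : 'I_4 -> T, injective h &
    forall i j l, i != j -> i != l -> j != l -> c (h i) (h j) != c (h i) (h l).

Definition palette (S : {set T}) : {set K} :=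
  [set k | [exists x in S, exists y in S, (x != y) && (c x y == k)]].

Lemma paletteP (S : {set T}) k :
  reflect (exists x y, [/\ x \in S, y \in S, x != y & c x y = k])
          (k \in palette S).
Proof.
rewrite inE; apply: (iffP exists_inP) => [[x xS /exists_inP[y yS]]|].
  by case/andP=> xy /eqP <-; exists x, y.
case=> x [y [xS yS xy <-]]; exists x => //.
by apply/exists_inP; exists y; rewrite ?xy /=.
Qed.

(** A star at [v] within [S] whose edges have distinct colors, each of them lost
    from [S] when [v] is deleted. *)
Definition private_star (S : {set T}) v (A : {set T}) :=
  [/\ A \subset S :\ v, {in A &, injective (c v)} &
      forall w, w \in A -> c v w \notin palette (S :\ v)].

(** A color lost by deleting [v] lies on an edge at [v], so one leaf can be
    chosen for each lost color. *)
Lemma private_starP (S : {set T}) v :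
  exists A, private_star S v A /\ #|palette S| <= #|palette (S :\ v)| + #|A|.
Proof.
pose P := palette S :\: palette (S :\ v).
pose leaf k := odflt v [pick w in S :\ v | c v w == k].
have leafP k : k \in P -> leaf k \in S :\ v /\ c v (leaf k) = k.
  rewrite inE => /andP[kN /paletteP[x [y [xS yS xy cxy]]]].
  rewrite /leaf; case: pickP => [w /andP[? /eqP]//|none]; exfalso.
  have [xv|xv] := eqVneq x v.
    by have := none y; rewrite /= !inE -xv eq_sym xy yS cxy eqxx.
  have [yv|yv] := eqVneq y v.
    by have := none x; rewrite /= !inE -yv xy xS c_sym cxy eqxx.
  by move/paletteP: kN; apply; exists x, y; rewrite !inE xv yv.
have leaf_inj : {in P &, injective leaf}.
  by move=> k l kP lP e; rewrite -(leafP k kP).2 -(leafP l lP).2 e.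
exists (leaf @: P); split; last first.
  rewrite card_in_imset // -(cardsID (palette (S :\ v)) (palette S)).
  by rewrite leq_add2r subset_leq_card // finset.subsetIr.
split.
- by apply/fintype.subsetP => _ /imsetP[k kP ->]; case: (leafP k kP).
- move=> _ _ /imsetP[k kP ->] /imsetP[l lP ->].
  by rewrite (leafP k kP).2 (leafP l lP).2 => ->.
- move=> _ /imsetP[k kP ->]; rewrite (leafP k kP).2.
  by move: kP; rewrite inE => /andP[].
Qed.

(** In the K4 spanned by [v], [v'] and two common leaves, the edge between the
    leaves and the star edges of [v'] avoid [v], so privacy keeps their colors
    away from those at [v]; symmetrically for [v'].  The only possible trouble
    is the edge [v v']: in each star its color is that of at most one leaf, so
    two of the four common leaves survive. *)
Lemma private_stars_K4 (S : {set T}) v v' A A' :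
  v \in S -> v' \in S -> v != v' ->
  private_star S v A -> private_star S v' A' ->
  3 < #|A :&: A'| -> properly_colored_K4.
Proof.
move=> vS v'S vv' [AS Ainj Apriv] [A'S A'inj A'priv] big.
pose bad := [set b in A | c v b == c v v'].
pose bad' := [set b in A' | c v' b == c v v'].
have card_bad : #|bad| <= 1.
  apply/card_le1_eqP => x y; rewrite !inE.
  move=> /andP[xA /eqP ex] /andP[yA /eqP ey].
  by apply: Ainj => //; rewrite ex ey.
have card_bad' : #|bad'| <= 1.
  apply/card_le1_eqP => x y; rewrite !inE.
  move=> /andP[xA /eqP ex] /andP[yA /eqP ey].
  by apply: A'inj => //; rewrite ex ey.
have : 1 < #|(A :&: A') :\: (bad :|: bad')|.
  have := cardsID (bad :|: bad') (A :&: A').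
  have := subset_leq_card (finset.subsetIr (A :&: A') (bad :|: bad')).
  have := (leq_card_setU bad bad').1.
  lia.
case/card_gt1P => b [b' []]; rewrite !inE => /andP[bN /andP[bA bA']].
move=> /andP[b'N /andP[b'A b'A']] bb'.
move: bN b'N; rewrite bA bA' b'A b'A' /= !negb_or.
move=> /andP[k1 k2] /andP[k3 k4].
have inS w : w \in A -> w \in A' -> [/\ w \in S, w != v & w != v'].
  move=> /(fintype.subsetP AS) + /(fintype.subsetP A'S).
  by rewrite !inE => /andP[-> ->] /andP[->].
have [bS bv bv'] := inS b bA bA'; have [b'S b'v b'v'] := inS b' b'A b'A'.
have sep w x y : w \in A -> x \in S -> y \in S -> x != v -> y != v -> x != y ->
    c v w != c x y.
  move=> wA xS yS xv yv xy; apply: contraNneq (Apriv w wA) => ->.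
  by apply/paletteP; exists x, y; rewrite !inE xv yv.
have sep' w x y : w \in A' -> x \in S -> y \in S -> x != v' -> y != v' ->
    x != y -> c v' w != c x y.
  move=> wA xS yS xv yv xy; apply: contraNneq (A'priv w wA) => ->.
  by apply/paletteP; exists x, y; rewrite !inE xv yv.
have e1 : c v b != c v b' by apply: contra_neq bb'; exact: Ainj.
have e2 : c v' b != c v' b' by apply: contra_neq bb'; exact: A'inj.
have v'v : v' != v by rewrite eq_sym.
have e3 : c v b != c v' b by apply: sep; rewrite // eq_sym.
have e4 : c v b' != c v' b' by apply: sep; rewrite // eq_sym.
have e5 : c v b != c b b' by apply: sep.
have e6 : c v b' != c b b' by apply: sep.
have e7 : c v' b != c b b' by apply: sep'.
have e8 : c v' b' != c b b' by apply: sep'.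
exists (tnth [tuple v; v'; b; b']).
  apply/tuple_uniqP; rewrite /= !inE !negb_or vv' bb' /=.
  by rewrite ![v == _]eq_sym ![v' == _]eq_sym bv b'v bv' b'v'.
case=> [[|[|[|[|//]]]] i4]; case=> [[|[|[|[|//]]]] j4];
  case=> [[|[|[|[|//]]]] l4] //= _ _ _; rewrite ?(tnth_nth v) /=;
  rewrite ?[c v' v]c_sym ?[c b' b]c_sym ?[c b v]c_sym ?[c b v']c_sym
    ?[c b' v]c_sym ?[c b' v']c_sym //; by rewrite eq_sym.
Qed.

(** If [#|T| < k ^ 2], some vertex of [S] has at most [4 * k] private colors:
    otherwise [k] private stars, which share at most three leaves pairwise,
    would together have at least [k ^ 2] leaves. *)
Lemma card_palette_bound k (S : {set T}) :
  #|T| < k ^ 2 -> ~ properly_colored_K4 -> #|palette S| <= 4 * k * #|S|.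
Proof.
move=> Tk noK4; elim: {S}#|S| {-2}S (eqxx #|S|) => [|m IH] S /eqP Sm.
  suff -> : palette S = finset.set0 by rewrite cards0.
  apply/eqP; rewrite -finset.subset0; apply/fintype.subsetP => x.
  case/paletteP=> y [z [yS _ _ _]].
  by move/eqP: Sm; rewrite cards_eq0 => /eqP S0; rewrite S0 inE in yS.
have [A starA] := fin_all_exists (private_starP S).
have [/exists_inP[v vS vsmall]|/exists_inPn large] :=
  boolP [exists v in S, #|A v| <= 4 * k].
  have Sv : #|S :\ v| = m by move: Sm; rewrite (cardsD1 v S) vS => -[].
  have := IH _ (introT eqP Sv); have := (starA v).2.
  by rewrite Sv Sm mulnS; lia.
exfalso; have k_le_S : k <= #|S|.
  have /card_gt0P[v vS] : 0 < #|S| by rewrite Sm.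
  have := large v vS; have [[/subset_leq_card AS _ _] _] := starA v.
  have := subset_leq_card (subD1set S v); lia.
have /card_geqP[s [suniq ssize sS]] := k_le_S.
have : size s * k <= #|\bigcup_(u <- s) A u|.
  apply: (@leq_card_bigcup_almost_disjoint _ _ A 3) => //.
  - by rewrite ssize.
  - by move=> u /sS /large; rewrite -ltnNge => /ltnW.
  - move=> u v us vs uv; rewrite leqNgt; apply/negP => big.
    exact: noK4 (private_stars_K4 (sS u us) (sS v vs) uv
                                  (starA u).1 (starA v).1 big).
by rewrite ssize mulnn leqNgt (leq_ltn_trans (max_card _)).
Qed.

End ProperK4.

(** Colors are arbitrary natural numbers in [good_coloring], whereas palettes
    are counted over a finite type; as finitely many colors are used, they can
    be stored in an ordinal type without changing which edges agree. *)
Lemma leq_num_colors_palette n (c : {set 'I_n} -> nat) :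
  exists (K : finType) (d : 'I_n -> 'I_n -> K),
  [/\ forall x y, d x y = d y x,
      forall x y z w,
        (d x y == d z w) = (c [set x; y]%SET == c [set z; w]%SET) &
      num_colors c <= #|palette d [set: 'I_n]|].
Proof.
pose m := \max_e c e; pose d e : 'I_m.+1 := inord (c e).
have dK e : val (d e) = c e by rewrite /d /= inordK // ltnS leq_bigmax.
exists 'I_m.+1, (fun x y => d [set x; y]%SET); split.
- by move=> x y; rewrite finset.setUC.
- by move=> x y z w; rewrite -val_eqE !dK.
have -> : num_colors c = size (undup [seq d e | e in edges_K n]).
  rewrite /num_colors -(size_map val) -(undup_map_inj val_inj) -map_comp.
  by congr (size (undup _)); apply: eq_map => e /=; rewrite dK.
rewrite -(card_uniqP (undup_uniq _)); apply: subset_leq_card.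
apply/fintype.subsetP => k; rewrite mem_undup => /mapP[e].
rewrite mem_enum inE => /cards2P[x [y [xy ->]]] ->.
by apply/paletteP; exists x, y; rewrite !inE xy.
Qed.

Lemma good_coloring_P3_adjacent n (c : {set 'I_n} -> nat)
    (h : complete_graph 4 -> 'I_n) :
  good_coloring (complete_graph 4) (generated [:: path_graph 3]) c ->
  injective h ->
  exists i j l, [/\ i != j, i != l, j != l &
    c [set h i; h j]%SET = c [set h i; h l]%SET].
Proof.
move=> good hinj; have [k _] := good h hinj.
case/List.Exists_cons => [[f finj fadj]|/List.Exists_nil//].
pose o i (i3 : i < 3) : path_graph 3 := Ordinal i3.
pose p i (i3 : i < 3) := f (o i i3).
have /andP[a10 /eqP c10] := fadj (o 1 isT) (o 0 isT) isT.
have /andP[a12 /eqP c12] := fadj (o 1 isT) (o 2 isT) isT.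
exists (val (p 1 isT)), (val (p 0 isT)), (val (p 2 isT)); split => //.
  by apply/eqP => /val_inj /finj.
by rewrite c10 c12.
Qed.

Lemma g_K4_P3_upper n k : n < k ^ 2 ->
  g n (complete_graph 4) (generated [:: path_graph 3]) <= 4 * k * n.
Proof.
move=> nk; apply/bigmax_leqP => m /asboolP[c <- good].
have [K [d [dsym dE cd]]] := leq_num_colors_palette c.
apply: leq_trans cd _; rewrite -[X in _ <= _ * X]card_ord -cardsT.
apply: card_palette_bound => //; first by rewrite card_ord.
case=> h hinj proper.
have [i [j [l [ij il jl]]]] := good_coloring_P3_adjacent good hinj.
by move/eqP; rewrite -dE; apply/negP; exact: proper.
Qed.

(** * Rainbow bipartite graphs without C4 *)

(** A color class has only non-isolated vertices, so an embedded graph [F] must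
    have none either. *)
Lemma contains_color_class n (c : {set 'I_n} -> nat) (G F : sgraph)
    (h : G -> 'I_n) k (f : F -> G) :
  injective f -> (forall x y, edge x y -> color_rel c h k (f x) (f y)) ->
  (forall x : F, exists y, edge x y) -> contains (color_class c h k) F.
Proof.
move=> finj fcol noiso.
have fV x : [exists y, color_rel c h k (f x) y].
  by have [y /fcol xy] := noiso x; apply/existsP; exists (f y).
exists (fun x => exist _ (f x) (fV x)) => [x y /(congr1 val)/finj //|x y /fcol].
by [].
Qed.

Section BipartiteC4Free.

Variables (n : nat) (E : {set {set 'I_n}}) (side : pred 'I_n).

Hypothesis crossing : forall x y, [set x; y]%SET \in E -> side x != side y.
Hypothesis C4_free : forall x x' y y',
  side x -> side x' -> ~~ side y -> ~~ side y' -> x != x' -> y != y' ->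
  ~~ [&& [set x; y]%SET \in E, [set x; y']%SET \in E,
         [set x'; y]%SET \in E & [set x'; y']%SET \in E].

(** The successor keeps color 0 for the pairs outside [E]. *)
Definition rainbow_on (e : {set 'I_n}) : nat :=
  if e \in E then (enum_rank e).+1 else 0.

(** The class of color 0 works in every K4.  It contains all pairs within a
    side, hence a triangle if three vertices share a side.  Otherwise there
    are two on each side, and a crossing pair outside [E] joins the two
    monochromatic pairs into a P4. *)
Lemma rainbow_on_good :
  good_coloring (complete_graph 4)
    (generated [:: complete_graph 3; path_graph 4]) rainbow_on.
Proof.
move=> h hinj; pose col := color_rel (G := complete_graph 4) rainbow_on h 0.
have colE x y : x != y -> [set h x; h y]%SET \notin E -> col x y.
  by move=> xy /negbTE xyE; rewrite /col /color_rel /rainbow_on xyE eqxx andbT.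
have col_sym x y : col x y = col y x.
  by rewrite /col /color_rel edge_sym finset.setUC.
have same x y : x != y -> side (h x) = side (h y) -> col x y.
  by move=> xy s; apply: colE => //; apply/negP => /crossing; rewrite s eqxx.
have triangle (A : {set 'I_4}) b :
    (forall x, x \in A -> side (h x) = b) -> 2 < #|A| ->
    exists2 k, color_occurs rainbow_on h k &
      generated [:: complete_graph 3; path_graph 4]
        (color_class rainbow_on h k).
  move=> Ab /card_gt2P[x [y [z [[xA yA zA] [xy yz zx]]]]].
  have cxy : col x y by apply: same; rewrite ?(Ab x) ?(Ab y).
  have cyz : col y z by apply: same; rewrite ?(Ab z) ?(Ab y).
  have czx : col z x by apply: same; rewrite ?(Ab z) ?(Ab x).
  exists 0; first by exists x, y.
  apply: List.Exists_cons_hd.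
  apply: (@contains_color_class n rainbow_on (complete_graph 4)
            (complete_graph 3) h 0
            (tnth [tuple x; y; z])).
  - by apply/tuple_uniqP; rewrite /= !inE negb_or xy yz eq_sym zx.
  - case=> [[|[|[|//]]] i3]; case=> [[|[|[|//]]] j3] //= _;
    rewrite !(tnth_nth x) /=; by rewrite -/col // col_sym.
  - move=> i; exists (if i == ord0 then ord_max else ord0).
    by case: i => [[|[|[|]]]].
pose A := [set x | side (h x)]%SET.
have cardA : #|A| + #|~: A| = 4 by rewrite cardsC card_ord.
have [A3|A2] := ltnP 2 #|A|.
  by apply: (triangle A true) => // x; rewrite inE.
have [B3|B2] := ltnP 2 #|~: A|.
  by apply: (triangle (~: A) false) => // x; rewrite !inE => /negbTE.
have /card_gt1P[x [x' [xA x'A xx']]] : 1 < #|A| by lia.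
have /card_gt1P[y [y' [yB y'B yy']]] : 1 < #|~: A| by lia.
(* [x0 y0] is the missing crossing pair, the middle edge of the P4. *)
have [x0 [x1 [y0 [y1 [[x0A x1A y0B y1B] [x01 y01 xyE]]]]]] : exists x0 x1 y0 y1,
    [/\ x0 \in A, x1 \in A, y0 \in ~: A & y1 \in ~: A] /\
    [/\ x0 != x1, y0 != y1 & [set h x0; h y0]%SET \notin E].
  move: (xA) (x'A) (yB) (y'B); rewrite !inE => sx sx' sy sy'.
  have := C4_free sx sx' sy sy'; rewrite !(inj_eq hinj) => /(_ xx' yy').
  rewrite !negb_and => /or4P[] ?.
  - by exists x, x', y, y'.
  - by exists x, x', y', y; rewrite (eq_sym y').
  - by exists x', x, y, y'; rewrite (eq_sym x').
  - by exists x', x, y', y; rewrite (eq_sym y') (eq_sym x').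
move: x0A x1A y0B y1B; rewrite !inE => sx0 sx1 sy0 sy1.
have diff u v : side (h u) -> ~~ side (h v) -> u != v.
  by move=> su sv; apply: contraNneq sv => <-.
have c1 : col x1 x0 by apply: same; rewrite 1?eq_sym // sx0 sx1.
have c2 : col x0 y0 by apply: colE => //; exact: diff.
have c3 : col y0 y1 by apply: same; rewrite // (negbTE sy0) (negbTE sy1).
exists 0; first by exists x1, x0.
apply: List.Exists_cons_tl; apply: List.Exists_cons_hd.
apply: (@contains_color_class n rainbow_on (complete_graph 4)
          (path_graph 4) h 0
          (tnth [tuple x1; x0; y0; y1])).
- apply/tuple_uniqP; rewrite /= !inE !negb_or (eq_sym x1) x01 y01.
  by rewrite !diff.
- case=> [[|[|[|[|//]]]] i4]; case=> [[|[|[|[|//]]]] j4] //= _;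
  rewrite !(tnth_nth x) /=; by rewrite -/col // col_sym.
- case=> [[|[|[|[|//]]]] i4].
  + by exists (Ordinal (isT : 1 < 4)).
  + by exists (Ordinal (isT : 0 < 4)).
  + by exists (Ordinal (isT : 1 < 4)).
  + by exists (Ordinal (isT : 2 < 4)).
Qed.

Lemma leq_card_g_bipartite : E \subset edges_K n ->
  #|E| <= g n (complete_graph 4)
            (generated [:: complete_graph 3; path_graph 4]).
Proof.
move=> EK; apply: leq_trans (leq_g (ex_intro2 _ _ _ erefl rainbow_on_good)).
rewrite /num_colors cardE -(size_map rainbow_on).
apply: uniq_leq_size => [|k].
  rewrite map_inj_in_uniq ?enum_uniq // => e e'; rewrite !mem_enum => eE e'E.
  by rewrite /rainbow_on eE e'E => -[] /val_inj /enum_rank_inj.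
rewrite mem_undup => /mapP[e eE ->]; apply: map_f; rewrite mem_enum.
by apply: (fintype.subsetP EK); rewrite -mem_enum.
Qed.

End BipartiteC4Free.

(** * The affine plane *)

Section Incidence.

Local Open Scope ring_scope.

Variables (F : finFieldType) (n : nat) (phi : (F * F) + (F * F) -> 'I_n).
Hypothesis phi_inj : injective phi.

(** The incidence of the line y = a x + b, encoded as [inr (a, b)], with its
    point of abscissa [x]; the vertices of K_n outside the range of [phi] are
    left isolated. *)
Definition flag (t : F * F * F) : {set 'I_n} :=
  let: (x, a, b) := t in [set phi (inl (x, a * x + b)); phi (inr (a, b))]%SET.

Definition is_point (i : 'I_n) : bool := [exists p, phi (inl p) == i].

Lemma is_point_inl p : is_point (phi (inl p)).
Proof. by apply/existsP; exists p. Qed.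

Lemma is_point_inr l : is_point (phi (inr l)) = false.
Proof. by apply/existsP => -[p /eqP/phi_inj]. Qed.

Lemma flag_sides i j :
  [set i; j]%SET \in flag @: [set: F * F * F] -> is_point i ->
  exists x a b, i = phi (inl (x, a * x + b)) /\ j = phi (inr (a, b)).
Proof.
case/imsetP => -[[x a] b] _ /= eqF /existsP[p /eqP pE]; exists x, a, b.
have jL : phi (inr (a, b)) \in [set i; j]%SET by rewrite eqF !inE eqxx orbT.
have iP : i \in [set phi (inl (x, a * x + b)); phi (inr (a, b))]%SET.
  by rewrite -eqF !inE eqxx.
split.
  by move: iP; rewrite !inE -pE => /orP[/eqP//|/eqP/phi_inj].
by move: jL; rewrite !inE -pE => /orP[/eqP/phi_inj//|/eqP].
Qed.

Lemma flag_inj : injective flag.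
Proof.
move=> [[x a] b] [[x' a'] b'] e.
have P : phi (inl (x, a * x + b)) \in flag (x', a', b') by rewrite -e !inE eqxx.
have L : phi (inr (a, b)) \in flag (x', a', b') by rewrite -e !inE eqxx orbT.
move: P L; rewrite !inE.
move=> /orP[/eqP/phi_inj[-> _]|/eqP/phi_inj//].
by move=> /orP[/eqP/phi_inj//|/eqP/phi_inj[-> ->]].
Qed.

(** C4-freeness of the incidence graph says that two distinct points lie on at
    most one common line: lines of slopes [a] and [a1] through points of
    abscissas [x] and [x2] satisfy [(a - a1) * (x - x2) = 0]. *)
Lemma leq_incidence_g :
  (#|F| ^ 3 <= g n (complete_graph 4)
            (generated [:: complete_graph 3; path_graph 4]))%N.
Proof.
have -> : (#|F| ^ 3 = #|flag @: [set: F * F * F]|)%N.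
  by rewrite (card_imset _ flag_inj) cardsT !card_prod !expnS expn0 muln1 mulnA.
apply: (@leq_card_g_bipartite _ _ is_point).
- move=> i j ijE; have [iP|iL] := boolP (is_point i).
    by have [x [a [b [_ ->]]]] := flag_sides ijE iP; rewrite is_point_inr.
  have [jP|jL] := boolP (is_point j) => //.
  move/imsetP: ijE => [[[x a] b] _ /= eqF].
  have : phi (inl (x, a * x + b)) \in [set i; j]%SET by rewrite eqF !inE eqxx.
  rewrite !inE => /orP[]/eqP pE.
    by rewrite -pE is_point_inl in iL.
  by rewrite -pE is_point_inl in jL.
- move=> p q l m pP qP lL mL pq lm; apply/and4P => -[pl pm ql qm].
  have [x [a [b [pE lE]]]] := flag_sides pl pP.
  have [x1 [a1 [b1 [pE1 mE]]]] := flag_sides pm pP.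
  have [x2 [a2 [b2 [qE lE2]]]] := flag_sides ql qP.
  have [x3 [a3 [b3 [qE3 mE3]]]] := flag_sides qm qP.
  move: pE1; rewrite pE => /phi_inj[ex ey].
  move: lE2; rewrite lE => /phi_inj[ea eb].
  move: qE3; rewrite qE => /phi_inj[ex' ey'].
  move: mE3; rewrite mE => /phi_inj[ea' eb'].
  subst x1 a2 b2 x3 a3 b3.
  (* The line is not vertical, so distinct points have distinct abscissas. *)
  have neq : x != x2 by apply: contra_neq pq => xx; rewrite pE qE xx.
  have : (a - a1) * (x - x2) = 0.
    rewrite mulrBl !mulrBr.
    have -> : a * x = a1 * x + b1 - b by rewrite -ey addrK.
    have -> : a * x2 = a1 * x2 + b1 - b by rewrite -ey' addrK.
    by ring.
  move/eqP; rewrite mulf_eq0 !subr_eq0 (negbTE neq) orbF => /eqP aa.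
  move: lm ey; rewrite lE mE aa => lm /addrI bb.
  by rewrite bb eqxx in lm.
- apply/fintype.subsetP => e /imsetP[[[x a] b] _ ->]; rewrite inE /= cards2.
  by rewrite (inj_eq phi_inj).
Qed.

End Incidence.

Lemma g_K4_K3P4_lower n r : 0 < r -> 2 * (2 ^ r) ^ 2 <= n ->
  (2 ^ r) ^ 3 <= g n (complete_graph 4)
                   (generated [:: complete_graph 3; path_graph 4]).
Proof.
move=> r0 rn; have [F _ cardF] := pPrimePowerField (isT : prime 2) r0.
have cardle : #|{: (F * F) + (F * F)}| <= n.
  by rewrite card_sum !card_prod cardF; lia.
rewrite -cardF.
apply: (@leq_incidence_g F n (fun s => widen_ord cardle (enum_rank s))).
by move=> s t /(congr1 val) /= /val_inj /enum_rank_inj.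
Qed.

(** Both K3 and P4 contain P3: it sits on their first three vertices. *)
Lemma g_K3P4_le_P3 n :
  g n (complete_graph 4) (generated [:: complete_graph 3; path_graph 4]) <=
  g n (complete_graph 4) (generated [:: path_graph 3]).
Proof.
apply/bigmax_leqP => m /asboolP[c <- good]; apply: leq_g; exists c => //.
move=> h hinj; have [k occ cl] := good h hinj; exists k => //.
apply: List.Exists_cons_hd.
case/List.Exists_cons: cl => [[f finj fadj]|].
  exists f => // x y xy; apply: fadj.
  by apply: contraTneq xy => ->; rewrite edge_irr.
case/List.Exists_cons => [[f finj fadj]|/List.Exists_nil//].
exists (fun i : 'I_3 => f (widen_ord (isT : 3 <= 4) i)).
  by move=> x y /finj /(congr1 (@nat_of_ord 4)) /= /val_inj.
by move=> x y xy; apply: fadj.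
Qed.

(** * Order of growth *)

Lemma dyadic_square_scale n : 8 <= n ->
  exists2 r, 0 < r & 2 * (2 ^ r) ^ 2 <= n < 8 * (2 ^ r) ^ 2.
Proof.
move=> n8; have half0 : 0 < n./2 by lia.
pose r := trunc_log 4 n./2; exists r; first by rewrite trunc_log_gt0; lia.
have -> : (2 ^ r) ^ 2 = 4 ^ r by rewrite -expnM mulnC expnM.
by have /andP[] := trunc_log_bounds (isT : 1 < 4) half0; rewrite -/r expnS; lia.
Qed.

Local Open Scope classical_set_scope.
Local Open Scope ring_scope.

(** With q = 2^r in this range, q <= sqrt n <= 3q, while n^(3/2) = n sqrt n is
    the cube of sqrt n; this gives the constants 1/27 and 12. *)
Lemma bigTheta_n32 (R : realType) (f : nat -> nat) :
  (forall n r, (0 < r)%N -> (2 * (2 ^ r) ^ 2 <= n < 8 * (2 ^ r) ^ 2)%N ->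
    ((2 ^ r) ^ 3 <= f n <= 12 * 2 ^ r * n)%N) ->
  (fun n => (f n)%:R : R) \is 'Theta_\oo (fun n : nat => n%:R `^ (3 / 2) : R).
Proof.
move=> fP; rewrite qualifE; apply/asboolP; exists (27^-1, 12) => /=.
  by rewrite invr_gt0 !ltr0n.
exists 8%N => // n /= n8; have [r r0 rn] := dyadic_square_scale n8.
have /andP[lo hi] := fP n r r0 rn; case/andP: rn => rn nr.
have n0 : (n%:R : R) != 0 by rewrite pnatr_eq0; lia.
have -> : n%:R `^ (3 / 2) = n%:R * Num.sqrt (n%:R : R).
  rewrite (_ : 3 / 2 = 1 + 2^-1); last by field.
  by rewrite powRD ?n0 ?implybT // powRr1 // powR12_sqrt.
set s := Num.sqrt _; have s0 : 0 <= s by exact: sqrtr_ge0.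
have s2 : s ^+ 2 = n%:R by rewrite sqr_sqrtr.
rewrite !ger0_norm ?mulr_ge0 //.
move: hi lo rn nr; set q := (2 ^ r)%N => hi lo rn nr.
have qs : q%:R <= s.
  rewrite -(@ler_pXn2r _ 2) ?nnegrE // s2 -natrX ler_nat; lia.
have sq : s <= 3 * q%:R.
  rewrite -(@ler_pXn2r _ 2) ?nnegrE ?mulr_ge0 // s2 exprMn.
  rewrite -!natrX -natrM ler_nat; lia.
split.
  rewrite ler_pdivrMl // -s2 -exprSr.
  apply: (@le_trans _ _ ((3 * q%:R) ^+ 3)).
    by apply: lerXn2r => //; rewrite nnegrE mulr_ge0.
  by rewrite exprMn -!natrX -!natrM ler_nat leq_mul.
apply: (@le_trans _ _ (12 * q * n)%:R); first by rewrite ler_nat.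
by rewrite !natrM [n%:R * s]mulrC mulrA ler_wpM2r // ler_wpM2l.
Qed.

Theorem theorem9p6 (R : realType) :
  ((fun n : nat => (g n (complete_graph 4)
      (generated [:: path_graph 3]))%:R : R)
    \is 'Theta_\oo (fun n : nat => n%:R `^ (3 / 2) : R)) /\
  ((fun n : nat => (g n (complete_graph 4)
      (generated [:: complete_graph 3; path_graph 4]))%:R : R)
    \is 'Theta_\oo (fun n : nat => n%:R `^ (3 / 2) : R)).
Proof.
have lower n r : (0 < r)%N -> (2 * (2 ^ r) ^ 2 <= n < 8 * (2 ^ r) ^ 2)%N ->
    ((2 ^ r) ^ 3 <= g n (complete_graph 4)
       (generated [:: complete_graph 3; path_graph 4]))%N.
  by move=> r0 /andP[rn _]; exact: g_K4_K3P4_lower.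
have upper n r : (2 * (2 ^ r) ^ 2 <= n < 8 * (2 ^ r) ^ 2)%N ->
    (g n (complete_graph 4) (generated [:: path_graph 3]) <= 12 * 2 ^ r * n)%N.
  (* Since n < 8 q^2 < (3 q)^2, the upper bound applies with k = 3 q. *)
  move=> /andP[_ nr]; rewrite (_ : 12 * 2 ^ r = 4 * (3 * 2 ^ r))%N; last by lia.
  by apply: g_K4_P3_upper; lia.
have sub n := g_K3P4_le_P3 n.
split; apply: bigTheta_n32 => n r r0 rn.
- by rewrite upper // andbT (leq_trans (lower _ _ r0 rn)).
- by rewrite lower //= (leq_trans (sub n)) // upper.
Qed.
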